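(* Let $m,n$ be positive integers with $m\neq n$ and let $A$ be an $m\times n$ complex matrix. Then $$w(A)=\{z\in\mathbb{C} : |z|\le \|A\|_2\}.$$
   Context: For an $m\times n$ complex matrix $A$, $w(A)=\{y^*Ax : x\in\mathbb{C}^n,\ y\in\mathbb{C}^m,\ \|x\|_2=\|y\|_2=1\}$. Here $\|A\|_2$ is the spectral norm (the largest singular value of $A$). *)

(* Defs.v *)
From mathcomp Require Import all_boot all_order all_algebra.
From mathcomp Require Import sesquilinear spectral complex.
From mathcomp Require Import classical_sets reals.

Set Implicit Arguments.
Unset Strict Implicit.
Unset Printing Implicit Defensive.

Import Order.TTheory GRing.Theory Num.Theory.
Local Open Scope ring_scope.
Local Open Scope classical_set_scope.
Local Open Scope sesquilinear_scope.

(* Norms on a [numClosedFieldType] [C] are [C]-valued, as in MathComp;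
   [M ^t*] is the conjugate transpose. *)
Definition l2norm (C : numClosedFieldType) (n : nat) (x : 'cV[C]_n) : C :=
  sqrtC (\sum_i `|x i 0| ^+ 2).

Definition numrange (C : numClosedFieldType) (m n : nat) (A : 'M[C]_(m, n)) :
    set C :=
  [set z | exists (x : 'cV[C]_n) (y : 'cV[C]_m),
     [/\ l2norm x = 1, l2norm y = 1 & z = (y^t* *m A *m x) 0 0]].

(* For m < n this also contains the square roots of the n - m extra zero
   eigenvalues of A^* A; that never affects the largest element. *)
Definition singular_values (R : realType) (m n : nat) (A : 'M[R[i]]_(m, n)) :
    set R :=
  [set s | 0 <= s /\ eigenvalue (A^t* *m A) (s%:C%C ^+ 2)].

(* The supremum is attained as soon as 0 < n, see [spectral_normP]. *)
Definition spectral_norm (R : realType) (m n : nat) (A : 'M[R[i]]_(m, n)) : R :=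
  sup (singular_values A).

Lemma gram_eigenvalue_ge0 (C : numClosedFieldType) (m n : nat)
    (A : 'M[C]_(m, n)) (a : C) : eigenvalue (A^t* *m A) a -> 0 <= a.
Proof.
have nrm k (u : 'rV[C]_k) : (u *m u^t*) 0 0 = \sum_j `|u 0 j| ^+ 2.
  by rewrite mxE; apply: eq_bigr => j _; rewrite !mxE normCK.
have nrm_ge0 k (u : 'rV[C]_k) : 0 <= (u *m u^t*) 0 0.
  by rewrite nrm sumr_ge0 // => j _; rewrite exprn_ge0.
move=> /eigenvalueP [v vE v0].
have vv_gt0 : 0 < (v *m v^t*) 0 0.
  rewrite lt_def nrm_ge0 andbT; apply: contra_neq v0; rewrite nrm => /eqP.
  rewrite psumr_eq0 => [/allP h|j _]; last by rewrite exprn_ge0.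
  apply/rowP => j; have := h j (mem_index_enum _).
  by rewrite /= sqrf_eq0 normr_eq0 mxE => /eqP.
have := nrm_ge0 _ (v *m A^t*).
rewrite trmx_mul map_mxM /= trmxCK mulmxA -(mulmxA v) vE -scalemxAl mxE.
by rewrite pmulr_lge0.
Qed.

Lemma spectral_normP (R : realType) (m n : nat) (A : 'M[R[i]]_(m, n)) :
  (0 < n)%N ->
  singular_values A (spectral_norm A) /\
  (forall s, singular_values A s -> s <= spectral_norm A).
Proof.
move=> n_gt0; set B := A^t* *m A.
have [rs rsE] := closed_field_poly_normal (char_poly B).
have B_eig a : eigenvalue B a = (a \in rs).
  rewrite eigenvalue_root_char rsE (monicP (char_poly_monic _)) scale1r.
  by rewrite root_prod_XsubC.
pose ss := [seq Num.sqrt (complex.Re z) | z <- rs].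
have sqC (s : R) : s%:C%C ^+ 2 = (s ^+ 2)%:C%C.
  by rewrite -(rmorphXn (real_complex R)).
have rsS z : z \in rs -> singular_values A (Num.sqrt (complex.Re z)).
  rewrite -B_eig => zB; split; first exact: sqrtr_ge0.
  have /andP[/eqP z_re z_ge0] : (complex.Im z == 0) && (0 <= complex.Re z).
    by have := gram_eigenvalue_ge0 zB; rewrite lecE.
  suff -> : (Num.sqrt (complex.Re z))%:C%C ^+ 2 = z by [].
  by rewrite sqC sqr_sqrtr //; apply/eqP; rewrite eq_complex /= z_re !eqxx.
have SE s : singular_values A s <-> s \in ss.
  split=> [[s0]|/mapP[z /rsS zS ->] //].
  rewrite -/B B_eig => srs; apply/mapP; exists (s%:C%C ^+ 2) => //.
  by rewrite sqC sqrtr_sqr ger0_norm.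
have maxP (t : seq R) : t != [::] ->
    exists2 x, x \in t & forall y, y \in t -> y <= x.
  elim: t => [//|a [|b t] IH _].
    by exists a => [|y]; rewrite inE // => /eqP ->.
  have [//|x xt xmax] := IH; have [ax|xa] := leP a x.
    by exists x => [|y]; rewrite inE ?xt ?orbT // => /predU1P[->//|/xmax].
  exists a => [|y]; rewrite inE ?eqxx // => /predU1P[->//|/xmax yx].
  exact: le_trans yx (ltW xa).
have ss0 : ss != [::].
  have [a] := eigenvalue_closed B n_gt0.
  by rewrite B_eig /ss; case: (rs).
have [x /SE xS xmax] := maxP _ ss0.
have ubx : ubound (singular_values A) x by move=> s /SE; exact: xmax.
suff -> : spectral_norm A = x by split.
apply/eqP; rewrite eq_le; apply/andP; split.
  by apply: ge_sup => //; exists x.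
by apply: ub_le_sup => //; exists x.
Qed.

(* Main.v *)
(* For unit x and y, Cauchy-Schwarz and the Rayleigh bound for A^* A give
   |y^* A x| <= s, where s is the spectral norm of A.  Conversely, if s <> 0,
   let u be a unit eigenvector of A^* A for s^2, let v = A u / s, and let
   |t| <= 1 with r = sqrt (1 - |t|^2).  As m <> n, there is a unit vector k
   with A k = 0 or with k^* A = 0.  In the first case k is orthogonal to u,
   and x = t u + r k, y = v give y^* A x = t s; in the second case k is
   orthogonal to v, and x = u, y = t^* v + r k give the same value. *)
Require Import Defs.
From mathcomp Require Import all_boot all_order all_algebra.
From mathcomp Require Import sesquilinear spectral.
From mathcomp Require Import complex classical_sets reals.

Import Order.TTheory GRing.Theory Num.Theory.
Local Open Scope ring_scope.
Local Open Scope classical_set_scope.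
Local Open Scope sesquilinear_scope.

Section ConjugateTranspose.
Context {C : numClosedFieldType}.

Lemma trmxC_mul {m n p} (A : 'M[C]_(m, n)) (B : 'M[C]_(n, p)) :
  (A *m B)^t* = B^t* *m A^t*.
Proof. by rewrite trmx_mul map_mxM. Qed.

Lemma trmxCD {m n} (A B : 'M[C]_(m, n)) : (A + B)^t* = A^t* + B^t*.
Proof. by rewrite linearD /= map_mxD. Qed.

Lemma trmxCZ {m n} (a : C) (A : 'M[C]_(m, n)) : (a *: A)^t* = a^* *: A^t*.
Proof. by rewrite linearZ /= map_mxZ. Qed.

Lemma gram_trmxC {m n} (A : 'M[C]_(m, n)) : (A^t* *m A)^t* = A^t* *m A.
Proof. by rewrite trmxC_mul trmxCK. Qed.

Lemma dot_sum {n} (x : 'cV[C]_n) : (x^t* *m x) 0 0 = \sum_i `|x i 0| ^+ 2.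
Proof. by rewrite mxE; apply: eq_bigr => i _; rewrite !mxE mulrC normCK. Qed.

Lemma dot_ge0 {n} (x : 'cV[C]_n) : 0 <= (x^t* *m x) 0 0.
Proof. by rewrite dot_sum sumr_ge0 // => i _; rewrite exprn_ge0. Qed.

Lemma l2norm_sqr {n} (x : 'cV[C]_n) : l2norm x ^+ 2 = (x^t* *m x) 0 0.
Proof. by rewrite sqrtCK dot_sum. Qed.

Lemma l2norm_ge0 {n} (x : 'cV[C]_n) : 0 <= l2norm x.
Proof. by rewrite sqrtC_ge0 -dot_sum dot_ge0. Qed.

Lemma l2norm_eq0 {n} (x : 'cV[C]_n) : (l2norm x == 0) = (x == 0).
Proof.
rewrite sqrtC_eq0 psumr_eq0 => [|i _]; last exact: exprn_ge0.
apply/allP/eqP => [x0|-> i _]; last by rewrite mxE normr0 expr0n eqxx.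
apply/colP => i; have /= := x0 i (mem_index_enum _).
by rewrite sqrf_eq0 normr_eq0 mxE => /eqP.
Qed.

Lemma l2norm_eq1P {n} (x : 'cV[C]_n) : l2norm x = 1 <-> x^t* *m x = 1%:M.
Proof.
split=> [x1|x1].
  by rewrite [LHS]mx11_scalar -l2norm_sqr x1 expr1n.
(* The square of the norm is 1, and nonnegativity excludes the root -1. *)
have /eqP := l2norm_sqr x; rewrite x1 mxE /= sqrf_eq1 => /orP[/eqP //|/eqP xN1].
by have := l2norm_ge0 x; rewrite xN1 oppr_ge0 ler10.
Qed.

Lemma l2norm_normalize {n} (x : 'cV[C]_n) :
  x != 0 -> l2norm ((l2norm x)^-1 *: x) = 1.
Proof.
rewrite -l2norm_eq0 => x0; apply/l2norm_eq1P.
rewrite trmxCZ -scalemxAl -scalemxAr scalerA [_ *m _]mx11_scalar -l2norm_sqr.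
rewrite geC0_conj ?invr_ge0 ?l2norm_ge0 // scale_scalar_mx.
by rewrite -expr2 -exprMn mulVf // expr1n.
Qed.

(** Pythagoras: both cross terms vanish, one being the adjoint of the other. *)
Lemma unit_comb {n} (a b : C) (u k : 'cV[C]_n) :
  l2norm u = 1 -> l2norm k = 1 -> k^t* *m u = 0 -> `|a| ^+ 2 + `|b| ^+ 2 = 1 ->
  l2norm (a *: u + b *: k) = 1.
Proof.
move=> /l2norm_eq1P u1 /l2norm_eq1P k1 ku0 ab1; apply/l2norm_eq1P.
have uk0 : u^t* *m k = 0.
  by rewrite -[LHS]trmxCK trmxC_mul (trmxCK u) ku0 trmx0 map_mx0.
rewrite trmxCD !trmxCZ mulmxDl !mulmxDr -!scalemxAl -!scalemxAr u1 k1 uk0 ku0.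
rewrite !scaler0 addr0 add0r !scalerA -scalerDl.
by rewrite ![_^* * _]mulrC -!normCK ab1 scale1r.
Qed.

Lemma cauchy_schwarz {n} (x y : 'cV[C]_n) :
  `|(y^t* *m x) 0 0| ^+ 2 <= (y^t* *m y) 0 0 * (x^t* *m x) 0 0.
Proof.
(* [dotmx] pairs row vectors and conjugates its second argument, so columns enter through their
   adjoints. *)
have : `|dotmx (y^t*) (x^t*)| ^+ 2 <=
    dotmx (y^t*) (y^t*) * dotmx (x^t*) (x^t*).
  exact: (CauchySchwarz (@dotmx C n) (y^t*) (x^t*)).1.
by rewrite 3!dotmxE (trmxCK x) (trmxCK y).
Qed.

(** The rank is at most n < m, so the left kernel is nonzero. Applied to [A^t*], this also serves
    wide matrices. *)
Lemma exists_unit_left_kernel {m n} (A : 'M[C]_(m, n)) : (n < m)%N ->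
  exists2 k : 'cV[C]_m, l2norm k = 1 & k^t* *m A = 0.
Proof.
move=> ltnm; pose v := nz_row (kermx A).
have v0 : v != 0.
  rewrite nz_row_eq0 -mxrank_eq0 mxrank_ker subn_eq0 -ltnNge.
  exact: leq_ltn_trans (rank_leq_col A) ltnm.
have vA : v *m A = 0 by apply/sub_kermxP; exact: nz_row_sub.
have vC0 : v^t* != 0.
  by apply: contra_neq v0 => vC0; rewrite -[v]trmxCK vC0 trmx0 map_mx0.
exists ((l2norm (v^t*))^-1 *: v^t*); first exact: l2norm_normalize.
by rewrite trmxCZ trmxCK -scalemxAl vA scaler0.
Qed.

(** In the unitary coordinates [P *m x] the form becomes a sum of the eigenvalues [d 0 i] weighted
    by squared moduli, and is bounded term by term. *)
Lemma rayleigh_le {n} (B : 'M[C]_n) (b : C) (x : 'cV[C]_n) :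
  B \is normalmx -> (forall a, eigenvalue B a -> a <= b) ->
  (x^t* *m B *m x) 0 0 <= b * (x^t* *m x) 0 0.
Proof.
move=> /orthomx_spectralP; set P := spectralmx B; set d := spectral_diag B.
have PU : P \is unitarymx := spectral_unitarymx B.
have Punit : P \in unitmx := unitarymx_unit PU.
move=> BE Bb.
(* Row i of [P] is a left eigenvector; it is nonzero because [P] is invertible. *)
have d_eig i : eigenvalue B (d 0 i).
  apply/eigenvalueP; exists (row i P); last first.
    apply: contraTneq Punit => Pi0; rewrite -row_free_unit.
    apply/negP => /row_freeP[Q PQ]; have := congr1 (row i) PQ.
    rewrite row_mul Pi0 mul0mx => /rowP/(_ i)/eqP.
    by rewrite !mxE eqxx eq_sym oner_eq0.
  rewrite {1}BE !mulmxA -row_mul mulmxV // row1 -rowE row_diag_mx.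
  by rewrite -scalemxAl -rowE.
have -> : x^t* *m B *m x = (P *m x)^t* *m diag_mx d *m (P *m x).
  by rewrite BE trmxC_mul invmx_unitary // !mulmxA.
have -> : x^t* *m x = (P *m x)^t* *m (P *m x).
  by rewrite trmxC_mul -invmx_unitary // mulmxA mulmxKV.
rewrite -mulmxA mul_diag_mx dot_sum mulr_sumr mxE; apply: ler_sum => i _.
rewrite !mxE mulrCA -[X in _ * X]mulrC -normCK ler_wpM2r ?exprn_ge0 //.
exact: Bb.
Qed.

End ConjugateTranspose.

Section SpectralNorm.
Context {R : realType} {m n : nat} (A : 'M[R[i]]_(m, n)).
Let s : R[i] := (spectral_norm A)%:C%C.

(** As [a] is nonnegative, its square root is real and nonnegative, hence a singular value. *)
Lemma gram_eigenvalue_le (a : R[i]) : (0 < n)%N ->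
  eigenvalue (A^t* *m A) a -> a <= s ^+ 2.
Proof.
move=> n_gt0 Aa; have a_ge0 := gram_eigenvalue_ge0 Aa.
have [[s_ge0 _] s_max] := spectral_normP A n_gt0.
have sqrt_a_ge0 : 0 <= sqrtC a by rewrite sqrtC_ge0.
have /andP[/eqP im0 re_ge0] :
    (complex.Im (sqrtC a) == 0) && (0 <= complex.Re (sqrtC a)).
  by have := sqrt_a_ge0; rewrite lecE.
have sE : (complex.Re (sqrtC a))%:C%C = sqrtC a.
  by apply/eqP; rewrite eq_complex /= im0 !eqxx.
have /s_max le_s : singular_values A (complex.Re (sqrtC a)).
  by split; [exact: re_ge0 | rewrite sE sqrtCK].
rewrite -[a]sqrtCK -sE.
by rewrite ler_sqr ?nnegrE lecR.
Qed.

Lemma numrange_le (z : R[i]) : (0 < n)%N -> numrange A z -> `|z| <= s.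
Proof.
move=> n_gt0 [x [y [/l2norm_eq1P x1 /l2norm_eq1P y1 ->]]].
have [[s_ge0 _] _] := spectral_normP A n_gt0.
rewrite -ler_sqr ?nnegrE ?normr_ge0 ?lecR // -mulmxA.
apply: le_trans (cauchy_schwarz _ _) _.
(* The remaining factor, the squared norm of A x, is the quadratic form of the Gram matrix at
   [x]. *)
rewrite y1 mxE mul1r trmxC_mul mulmxA -(mulmxA _ _ A).
apply: le_trans (rayleigh_le _ (s ^+ 2) _ _ _) _.
- by apply/normalmxP; rewrite gram_trmxC.
- by move=> a; exact: gram_eigenvalue_le.
- by rewrite x1 mxE mulr1.
Qed.

(** [eigenvalue] supplies a left eigenvector; its adjoint is a right one, since the Gram matrix is
    Hermitian and s^2 is real. *)
Lemma exists_top_singular_vector : (0 < n)%N ->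
  exists2 u : 'cV[R[i]]_n, l2norm u = 1 & A^t* *m A *m u = s ^+ 2 *: u.
Proof.
move=> n_gt0; have [[s_ge0 /eigenvalueP[v vE v0]] _] := spectral_normP A n_gt0.
have vC0 : v^t* != 0.
  by apply: contra_neq v0 => vC0; rewrite -[v]trmxCK vC0 trmx0 map_mx0.
exists ((l2norm (v^t*))^-1 *: v^t*); first exact: l2norm_normalize.
rewrite -scalemxAr -gram_trmxC -trmxC_mul vE trmxCZ geC0_conj.
  by rewrite !scalerA mulrC.
by rewrite exprn_ge0 // lecR.
Qed.

Lemma numrange_ge (z : R[i]) : (0 < m)%N -> (0 < n)%N -> m <> n ->
  `|z| <= s -> numrange A z.
Proof.
move=> m_gt0 n_gt0 /eqP neq_mn le_zs.
have s_ge0 : 0 <= s by rewrite lecR; have [[]] := spectral_normP A n_gt0.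
have [u u1 uE] := exists_top_singular_vector n_gt0.
have uu1 : u^t* *m u = 1%:M by exact/l2norm_eq1P.
have [s0|s_neq0] := eqVneq s 0.
  have z0 : z = 0 by apply/eqP; rewrite -normr_le0 -s0.
  have [y y0] : exists y : 'cV[R[i]]_m, y != 0.
    exists (const_mx 1); apply/eqP => /colP/(_ (Ordinal m_gt0))/eqP.
    by rewrite !mxE oner_eq0.
  have y1 := l2norm_normalize _ y0.
  exists u, ((l2norm y)^-1 *: y); split=> //; rewrite z0; apply/esym/eqP.
  rewrite -normr_le0 -s0; apply: numrange_le => //.
  by exists u, ((l2norm y)^-1 *: y).
have s_conj : (s^-1)^* = s^-1 by rewrite geC0_conj // invr_ge0.
have [v vE] : exists v, v = s^-1 *: (A *m u) by exists (s^-1 *: (A *m u)).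
have vAu : v^t* *m A *m u = s%:M.
  rewrite vE trmxCZ trmxC_mul s_conj -!scalemxAl -!mulmxA (mulmxA _ A) uE.
  by rewrite -scalemxAr uu1 scalerA expr2 mulKf // scalemx1.
have v1 : l2norm v = 1.
  apply/l2norm_eq1P; rewrite {2}vE -scalemxAr mulmxA vAu.
  by rewrite scale_scalar_mx mulVf.
pose t := z / s; pose r := sqrtC (1 - `|t| ^+ 2).
have tr1 : `|t| ^+ 2 + `|r| ^+ 2 = 1.
  (* The bound on |z| gives |t| <= 1, so [r] is real and nonnegative. *)
  rewrite [`|r|]ger0_norm ?sqrtCK ?subrKC // sqrtC_ge0 subr_ge0 exprn_ile1 //.
  by rewrite normf_div (ger0_norm s_ge0) ler_pdivrMr ?mul1r // lt_def s_neq0.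
have ts : t * s = z by rewrite divfK.
move: neq_mn; rewrite neq_ltn => /orP[ltmn|ltnm].
  have [k k1 kA] := exists_unit_left_kernel (A^t*) ltmn.
  have Ak : A *m k = 0.
    by rewrite -[LHS]trmxCK trmxC_mul kA trmx0 map_mx0.
  have ku0 : k^t* *m u = 0.
    (* Here s^2 k^* u = k^* A^* A u = 0, because k^* A^* = 0. *)
    apply: (scalerI (expf_neq0 2 s_neq0)).
    by rewrite scalemxAr -uE !mulmxA kA !mul0mx scaler0.
  exists (t *: u + r *: k), v; split=> //; first exact: unit_comb.
  by rewrite mulmxDr -!scalemxAr vAu -mulmxA Ak mulmx0 scaler0 addr0 !mxE ts.
have [k k1 kA] := exists_unit_left_kernel A ltnm.
(* [v] lies in the range of [A], which k^* annihilates. *)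
have kv0 : k^t* *m v = 0 by rewrite vE -scalemxAr mulmxA kA mul0mx scaler0.
(* The coefficient of [v] is conjugated because y enters the form through its adjoint. *)
exists u, (t^* *: v + r *: k); split; first exact: u1.
  by apply: unit_comb; rewrite ?norm_conjC.
rewrite trmxCD !trmxCZ conjCK !mulmxDl -!scalemxAl kA mul0mx scaler0 addr0.
by rewrite vAu !mxE ts.
Qed.

End SpectralNorm.

Theorem proposition1 (R : realType) (m n : nat) (hm : (0 < m)%N)
    (hn : (0 < n)%N) (hmn : m <> n) (A : 'M[R[i]]_(m, n)) :
  numrange A = [set z : R[i] | `|z| <= (spectral_norm A)%:C%C].
Proof.
by apply/seteqP; split=> z; [exact: numrange_le | exact: numrange_ge].
Qed.
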